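(* Let $n>2$ and $0<s<\frac{n-2}{4}$. Then $$\gamma_s v_n^{\frac{n-s}{n}}\,\frac{n-2-4s}{2s(n-2-s)}\leq \mathcal{C}_{n,s}\leq \gamma_s v_n^{\frac{n-s}{n}}\,\frac{n}{s}.$$
   Context: Here $n$ is the dimension of $\mathbb{R}^n$ and $v_n$ is the volume of the unit ball in $\mathbb{R}^n$. For $0<s<n$, the Riesz potential of $f$ is $$I_{s}(f)(x)=\gamma_s\int_{\mathbb{R}^n}\frac{f(x-y)}{|y|^{n-s}}\,dy,\qquad \gamma_s=2^{-s}\pi^{-\frac{n}{2}}\frac{\Gamma(\frac{n-s}{2})}{\Gamma(\frac{s}{2})}.$$ The weak quasinorm is $$\|g\|_{L^{\frac{n}{n-s},\infty}(\mathbb{R}^n)}=\sup_{\lambda>0}\lambda\,|\{x\in\mathbb{R}^n:|g(x)|>\lambda\}|^{\frac{n-s}{n}},$$ where $|E|$ denotes the Lebesgue measure of $E$. The constant $\mathcal{C}_{n,s}$ is the best constant in the $(L^1,L^{\frac{n}{n-s},\infty})$ estimate for $I_s$: $$\mathcal{C}_{n,s}=\sup_{f\in L^{1}(\mathbb{R}^n)}\frac{\|I_s(f)\|_{L^{\frac{n}{n-s},\infty}(\mathbb{R}^n)}}{\|f\|_{L^{1}(\mathbb{R}^n)}},$$ the supremum being over $f$ not identically zero (a.e.). *)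

(* Defs.v *)
From HB Require Import structures.
From mathcomp Require Import all_boot all_order all_algebra.
From mathcomp Require Import all_classical all_reals all_analysis.
Set Implicit Arguments.
Unset Strict Implicit.
Unset Printing Implicit Defensive.
Import Order.TTheory GRing.Theory Num.Theory.
Import numFieldNormedType.Exports.

Local Open Scope classical_set_scope.
Local Open Scope ring_scope.
Local Open Scope ereal_scope.

(* R^n is n.-tuple R with the library's product sigma-algebra, i.e. the Borel
   sets of R^n.  Its Lebesgue measure lebesgue_n is the n-fold product of the
   one-dimensional one; lebesgue_n_box gives its values on boxes. *)
Section lebesgue_cons.
Context (R : realType) (n : nat).

Definition tuple_cons (p : measurableTypeR R * n.-tuple R) : n.+1.-tuple R :=
  [tuple of p.1 :: p.2].

Lemma measurable_tuple_cons : measurable_fun setT tuple_cons.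
Proof. exact: measurable_cons. Qed.

Definition tuple_uncons (x : n.+1.-tuple R) : measurableTypeR R * n.-tuple R :=
  (thead x, [tuple of behead x]).

Lemma measurable_tuple_uncons : measurable_fun setT tuple_uncons.
Proof.
apply: measurable_fun_pair; last exact: measurable_behead.
exact: (@measurable_tnth _ R n.+1 ord0).
Qed.

Lemma tuple_consK : cancel tuple_cons tuple_uncons.
Proof.
by move=> [a t]; rewrite /tuple_uncons theadE; congr pair; exact: val_inj.
Qed.

Lemma tuple_unconsK : cancel tuple_uncons tuple_cons.
Proof. by move=> x; rewrite [RHS]tuple_eta. Qed.

Variable mu : {sigma_finite_measure set (n.-tuple R) -> \bar R}.

Definition lebesgue_cons : set (n.+1.-tuple R) -> \bar R :=
  pushforward (lebesgue_measure \x mu) tuple_cons.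

Let lebesgue_cons0 : lebesgue_cons set0 = 0.
Proof. by rewrite /lebesgue_cons /pushforward preimage_set0 measure0. Qed.

Let lebesgue_cons_ge0 A : 0 <= lebesgue_cons A.
Proof. by rewrite /lebesgue_cons /pushforward measure_ge0. Qed.

Let lebesgue_cons_sigma_additive : semi_sigma_additive lebesgue_cons.
Proof. apply: measure_semi_sigma_additive; exact: measurable_tuple_cons. Qed.

HB.instance Definition _ := isMeasure.Build _ _ _ lebesgue_cons
  lebesgue_cons0 lebesgue_cons_ge0 lebesgue_cons_sigma_additive.

Let lebesgue_cons_sigma_finite : sigma_finite setT lebesgue_cons.
Proof.
have /sigma_finiteP[F [TF ndF Foo]] := sigma_finiteT (@lebesgue_measure R).
have /sigma_finiteP[G [TG ndG Goo]] := sigma_finiteT mu.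
exists (fun k => tuple_uncons @^-1` (F k `*` G k)).
  rewrite -preimage_bigcup (_ : \bigcup_k _ = setT) ?preimage_setT//.
  rewrite -setXTT TF TG; apply/seteqP; split => -[x y].
    by move=> [k _ []/= ? ?]; split; exists k.
  move=> [/= [k _ Fx] [m _ Gy]]; exists (maxn k m) => //; split.
  - by move: x Fx; exact/subsetPset/ndF/leq_maxl.
  - by move: y Gy; exact/subsetPset/ndG/leq_maxr.
move=> k; have [mF Fk] := Foo k; have [mG Gk] := Goo k; split.
  rewrite -[X in measurable X]setTI.
  by apply: measurable_tuple_uncons => //; exact: measurableX.
rewrite /lebesgue_cons /pushforward -comp_preimage.
rewrite (_ : _ \o _ = id) ?preimage_id; last first.
  by apply/funext => p /=; rewrite tuple_consK.
by rewrite product_measure1E// lte_mul_pinfty// ge0_fin_numE.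
Qed.

HB.instance Definition _ := Measure_isSigmaFinite.Build _ _ _ lebesgue_cons
  lebesgue_cons_sigma_finite.

End lebesgue_cons.

Fixpoint lebesgue_n (R : realType) (n : nat) :
    {sigma_finite_measure set (n.-tuple R) -> \bar R} :=
  match n with
  | 0 => @dirac _ (0.-tuple R) [tuple] R
  | n.+1 => lebesgue_cons (lebesgue_n R n)
  end.

Lemma measurable_box (R : realType) (n : nat) (A : 'I_n -> set R) :
  (forall i, measurable (A i)) ->
  measurable [set x : n.-tuple R | forall i, A i (tnth x i)].
Proof.
move=> mA; rewrite (_ : [set x | _] =
    \bigcap_(i in [set: 'I_n]) (fun x : n.-tuple R => tnth x i) @^-1` A i).
  apply: fin_bigcap_measurable => // i _; rewrite -[X in measurable X]setTI.
  exact: measurable_tnth.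
by apply/seteqP; split => x Ax i; [move=> _|]; exact: Ax.
Qed.

Lemma lebesgue_n_box (R : realType) (n : nat) (A : 'I_n -> set R) :
  (forall i, measurable (A i)) ->
  lebesgue_n R n [set x | forall i, A i (tnth x i)] =
  \prod_(i < n) lebesgue_measure (A i).
Proof.
elim: n A => [|n IH] A mA.
  by rewrite big_ord0 /= diracE mem_set// => -[].
rewrite big_ord_recl -IH; last by move=> i; exact: mA.
rewrite -product_measure1E//; [|exact: mA|].
  rewrite /= /lebesgue_cons /pushforward; congr (_ _).
  apply/seteqP; split => -[a t] /=.
    move=> At; split; first exact: (At ord0).
    by move=> i; move: (At (lift ord0 i)); rewrite tnthS.
  move=> [A0 At] i; have [j ->|->] := unliftP ord0 i; last exact: A0.
  by rewrite tnthS; exact: At.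
by apply: (@measurable_box _ _ (fun i => A (lift ord0 i))) => i; exact: mA.
Qed.

Section riesz_potential.
Context (R : realType) (n : nat).
Local Notation mu := (lebesgue_n R n).

Definition tuple_sub (x y : n.-tuple R) : n.-tuple R :=
  [tuple (tnth x i - tnth y i)%R | i < n].

Definition eucl_norm (x : n.-tuple R) : R :=
  Num.sqrt (\sum_(i < n) tnth x i ^+ 2)%R.

Definition unit_ball_volume : \bar R := mu [set x | (eucl_norm x <= 1)%R].

Definition Gamma (a : R) : R :=
  (\int[lebesgue_measure]_(t in `]0%R, +oo[) (t `^ (a - 1) * expR (- t)))%R.

Definition riesz_const (s : R) : R :=
  (2 `^ (- s) * pi `^ (- (n%:R / 2)) *
   (Gamma ((n%:R - s) / 2) / Gamma (s / 2)))%R.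

(* For f in L^1 the integral converges absolutely for almost every x.  The
   library's value of the integrand at y = 0 (0) and its convention for
   divergent integrals are therefore only used on null sets. *)
Definition riesz_potential (s : R) (f : n.-tuple R -> R) (x : n.-tuple R) :
    \bar R :=
  (riesz_const s)%:E *
  \int[mu]_y (f (tuple_sub x y) / eucl_norm y `^ (n%:R - s))%:E.

(* The quasinorm of L^{n/(n-s),oo}. *)
Definition weak_norm (s : R) (g : n.-tuple R -> \bar R) : \bar R :=
  ereal_sup [set l%:E * mu [set x | l%:E < `|g x|] `^ ((n%:R - s) / n%:R)
            | l in [set l : R | (0 < l)%R]].

(* Functions in L^1 are represented by Borel functions; every Lebesgue class
   contains one.  The L^1 norm below is finite and positive on the index set. *)
Definition best_const (s : R) : \bar R :=
  ereal_sup [set weak_norm s (riesz_potential s f) / 'N[mu]_1[EFin \o f]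
            | f in [set f : n.-tuple R -> R | mu.-integrable setT (EFin \o f)
                     /\ ~ {ae mu, forall x, f x = 0%R}]].

End riesz_potential.

(* Main.v *)
Require Import Defs.
From mathcomp Require Import all_boot all_order all_algebra.
From mathcomp Require Import all_classical all_reals all_analysis.
From mathcomp Require Import measurable_realfun ring lra.
Import Order.TTheory GRing.Theory Num.Theory.
Import numFieldNormedType.Exports.
Set Implicit Arguments.
Unset Strict Implicit.
Unset Printing Implicit Defensive.
Local Open Scope classical_set_scope.
Local Open Scope ring_scope.
Local Open Scope ereal_scope.

(** Write [p = n - s], [K y = |y|^(-p)], [v] for the volume of the unit ball and
    [g] for the constant of the potential, so that [I_s f = g (f * K)].

    The superlevel set [{K >= t}] is a punctured ball of volume [v t^(-n/p)]
    ([lebesgue_n_riesz_kernel_superlevel]).  The layer cake formula then gives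
    the mass of the tail [(K - l)^+] and of [K] on [{K >= l}]
    ([integral_riesz_kernel_tail], [integral_riesz_kernel_superlevel]).

    Upper bound ([weak_norm_riesz_potential_le]).  Cut the kernel at height [l]:
    [K <= l + (K - l)^+].  The first part contributes at most [g l ||f||_1] to
    [|I_s f|] everywhere; the second has a convolution with [|f|] whose integral
    is [||f||_1] times the mass of the tail.  Chebyshev's inequality bounds the
    measure of [{|I_s f| > lambda}], and the choice
    [l = s lambda / (n g ||f||_1)], which optimizes the bound, yields exactly the
    factor [n / s].

    Lower bound ([best_const_ge]).  Test with the indicator [f] of the unit
    ball, for which [||f||_1 = v].  If [f * K >= L] on the ball of radius [t],
    the weak norm is at least [g L] times the volume of that ball to the power
    [p / n], so the best constant is at least [g v^(p/n)] times [t^p L / v].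
    Two choices of [t] suffice.
    - For [|x| <= 1 - r] the unit ball around [x] contains the ball of radius
      [r] around the origin, so [t = 1 - r] goes with [L = n v r^s / s].  With
      [r = 1 / (2 n)] and [s < 1/2] the factor [t^p L / v] is at least
      [1 / (2 s)], hence at least the claimed one ([best_const_ge_near]).
    - Any [t > 0] goes with [L = v (t + 1)^(-p)], because the unit ball around
      [x] lies in the ball of radius [t + 1] around the origin.  The factor
      [(t / (t + 1))^p] comes arbitrarily close to [1], and for [s >= 1/2] the
      claimed one is smaller than [1] ([best_const_ge_far]). *)

(** * Affine changes of variables *)

Definition tuple_affine (R : realType) (n : nat) (a : R) (b x : n.-tuple R) :
  n.-tuple R := [tuple (a * tnth x i + tnth b i)%R | i < n].

Lemma measurable_tuple_affine (R : realType) n (a : R) (b : n.-tuple R) :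
  measurable_fun setT (tuple_affine a b).
Proof.
apply/measurable_fun_tnthP => i.
rewrite (_ : _ \o _ =
    (fun x : n.-tuple R => a * tnth x i + tnth b i)%R); last first.
  by apply/funext => x /=; rewrite tnth_mktuple.
apply: measurable_funD => //; apply: measurable_funM => //.
exact: measurable_tnth.
Qed.

Lemma lebesgue_measure_affine (R : realType) (a b : R)
    (A : set (measurableTypeR R)) : a != 0%R -> measurable A ->
  `|a|%R%:E * lebesgue_measure ((fun x => a * x + b)%R @^-1` A) =
  lebesgue_measure A.
Proof.
move=> a0 mA.
pose T : measurableTypeR R -> measurableTypeR R := fun x => (a * x + b)%R.
have mT : measurable_fun setT T.
  by apply: measurable_funD => //; apply: measurable_funM.
have [m mE] : exists m : {measure set (measurableTypeR R) -> \bar R},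
    forall X, m X = `|a|%R%:E * lebesgue_measure (T @^-1` X).
  by unshelve eexists
    (mscale (NngNum (normr_ge0 a)) (pushforward lebesgue_measure T)).
(* By uniqueness of the Lebesgue measure it suffices to treat intervals. *)
rewrite -[LHS]mE; apply/esym.
apply: lebesgue_measure_unique => // _ [[c d] _ <-] /=; rewrite mE.
rewrite neq_lt in a0; have /orP[a_lt0|a_gt0] := a0; last first.
- have -> : T @^-1` `]c, d] = `]((c - b) / a)%R, ((d - b) / a)%R]%classic.
    apply/seteqP; split => x; rewrite /= !in_itv /= /T.
      by rewrite ltr_pdivrMr// ler_pdivlMr// mulrC; lra.
    by rewrite ltr_pdivrMr// ler_pdivlMr// mulrC; lra.
  rewrite !lebesgue_measure_itv /= !lte_fin ltr_pM2r ?invr_gt0// ltrD2r.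
  case: ifP; rewrite ?mule0// -EFinB -EFinM => _; congr EFin.
  by rewrite gtr0_norm//; field; rewrite gt_eqF.
- have -> : T @^-1` `]c, d] = `[((d - b) / a)%R, ((c - b) / a)%R[%classic.
    apply/seteqP; split => x; rewrite /= !in_itv /= /T.
      by rewrite ltr_ndivlMr// ler_ndivrMr// mulrC; lra.
    by rewrite ltr_ndivlMr// ler_ndivrMr// mulrC; lra.
  rewrite !lebesgue_measure_itv /= !lte_fin ltr_nM2r ?invr_lt0// ltrD2r.
  case: ifP; rewrite ?mule0// -EFinB -EFinM => _; congr EFin.
  by rewrite ltr0_norm//; field; rewrite lt_eqF.
Qed.

(** Induction on the dimension: the map acts coordinatewise, so the preimage of
    a rectangle is a rectangle, and the product measure is characterized by its
    values on rectangles. *)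
Lemma lebesgue_n_affine (R : realType) n (a : R) (b : n.-tuple R)
    (A : set (n.-tuple R)) : a != 0%R -> measurable A ->
  (`|a| ^+ n)%R%:E * lebesgue_n R n (tuple_affine a b @^-1` A) =
  lebesgue_n R n A.
Proof.
move=> a0; elim: n => [|n IH] in b A *.
  move=> mA; rewrite expr0 mul1e; congr (lebesgue_n R 0 _).
  by apply/seteqP; split => x /=; rewrite [tuple_affine _ _ _]tuple0 [x]tuple0.
move=> mA; have mT := measurable_tuple_affine a b.
pose u : measurableTypeR R * n.-tuple R -> _ :=
  fun p => tuple_uncons (tuple_affine a b (tuple_cons p)).
have mu_ : measurable_fun setT u.
  apply: (measurableT_comp (@measurable_tuple_uncons R n)).
  exact: (measurableT_comp mT (@measurable_tuple_cons R n)).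
have an0 : (0 <= `|a| ^+ n.+1)%R by rewrite exprn_ge0.
have [m mE] :
    exists m : {measure set (measurableTypeR R * n.-tuple R) -> \bar R},
    forall X, m X = (`|a| ^+ n.+1)%R%:E *
                    (lebesgue_measure \x lebesgue_n R n) (u @^-1` X).
  by unshelve eexists (mscale (NngNum an0)
                         (pushforward (lebesgue_measure \x lebesgue_n R n) u)).
have uE (p : measurableTypeR R * n.-tuple R) :
    u p = ((a * p.1 + thead b)%R, tuple_affine a [tuple of behead b] p.2).
  rewrite /u /tuple_uncons; congr pair.
    by rewrite /thead tnth_mktuple.
  apply: eq_from_tnth => i; rewrite tnth_mktuple !tnth_behead tnth_mktuple.
  have -> : inord i.+1 = lift ord0 i :> 'I_n.+1.
    by apply/val_inj; rewrite /= inordK// ltnS.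
  by rewrite tnthS.
have mcA : measurable (tuple_cons (n:=n) @^-1` A).
  by rewrite -[X in measurable X]setTI; exact: measurable_tuple_cons.
transitivity (m (tuple_cons (n:=n) @^-1` A)).
  rewrite mE; congr (_ * _); rewrite /= /lebesgue_cons /pushforward; congr (_ _).
  by apply/seteqP; split => p; rewrite /= tuple_unconsK.
apply/esym; apply: product_measure_unique => // B C mB mC.
have mB' : measurable
    ((fun x => a * x + thead b)%R @^-1` B : set (measurableTypeR R)).
  rewrite -[X in measurable X]setTI.
  have mg : measurable_fun setT
      (fun x : measurableTypeR R => (a * x + thead b)%R : measurableTypeR R).
    by apply: measurable_funD => //; apply: measurable_funM.
  exact: mg.
have mC' : measurable (tuple_affine a [tuple of behead b] @^-1` C).
  by rewrite -[X in measurable X]setTI; exact: measurable_tuple_affine.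
rewrite mE; have -> : u @^-1` (B `*` C) =
    (fun x => a * x + thead b)%R @^-1` B `*`
    (tuple_affine a [tuple of behead b] @^-1` C).
  by apply/seteqP; split => p; rewrite /preimage /mkset uE.
rewrite product_measure1E// exprS EFinM muleACA IH//.
by rewrite lebesgue_measure_affine.
Qed.

Section isometries.
Context (R : realType) (n : nat).
Local Notation mu := (lebesgue_n R n).

Lemma ge0_integral_affine (a : R) (b : n.-tuple R) (f : n.-tuple R -> \bar R) :
  `|a|%R = 1%R -> measurable_fun setT f -> (forall x, 0 <= f x) ->
  \int[mu]_x f (tuple_affine a b x) = \int[mu]_x f x.
Proof.
move=> a1 mf f0; have a0 : a != 0%R by rewrite -normr_eq0 a1 oner_eq0.
rewrite -(@ge0_integral_pushforward _ _ _ _ R _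
  (measurable_tuple_affine a b) mu setT f)//.
apply: eq_measure_integral => [|? A mA _]; first exact: measurable_tuple_affine.
by have := lebesgue_n_affine b a0 mA; rewrite a1 expr1n mul1e.
Qed.

Lemma ge0_integral_subl (x : n.-tuple R) (f : n.-tuple R -> \bar R) :
  measurable_fun setT f -> (forall x, 0 <= f x) ->
  \int[mu]_y f (tuple_sub x y) = \int[mu]_y f y.
Proof.
move=> mf f0; rewrite -(@ge0_integral_affine (-1)%R x f)// ?normrN1//.
apply: eq_integral => y _; congr f; apply: eq_from_tnth => i.
by rewrite !tnth_mktuple mulN1r addrC.
Qed.

Lemma ge0_integral_subr (y : n.-tuple R) (f : n.-tuple R -> \bar R) :
  measurable_fun setT f -> (forall x, 0 <= f x) ->
  \int[mu]_x f (tuple_sub x y) = \int[mu]_x f x.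
Proof.
move=> mf f0.
rewrite -(@ge0_integral_affine 1%R [tuple - tnth y i | i < n]%R f)// ?normr1//.
apply: eq_integral => x _; congr f; apply: eq_from_tnth => i.
by rewrite !tnth_mktuple mul1r.
Qed.

Lemma measurable_tuple_sub :
  measurable_fun setT (fun q : n.-tuple R * n.-tuple R => tuple_sub q.1 q.2).
Proof.
apply/measurable_fun_tnthP => i.
rewrite (_ : _ \o _ = (fun q : n.-tuple R * n.-tuple R =>
    tnth q.1 i - tnth q.2 i)%R); last first.
  by apply/funext => q /=; rewrite tnth_mktuple.
apply: measurable_funB.
  exact: (measurableT_comp (measurable_tnth i)).
exact: (measurableT_comp (measurable_tnth i)).
Qed.

Lemma measurable_tuple_subl (x : n.-tuple R) :
  measurable_fun setT (tuple_sub x).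
Proof. exact: (measurableT_comp measurable_tuple_sub (measurable_pair1 x)). Qed.

Lemma measurable_tuple_subr (y : n.-tuple R) :
  measurable_fun setT (fun x : n.-tuple R => tuple_sub x y).
Proof. exact: (measurableT_comp measurable_tuple_sub (measurable_pair2 y)). Qed.

End isometries.

(** * Euclidean balls and their volumes *)

Section euclidean_balls.
Context (R : realType) (n : nat).
Local Notation mu := (lebesgue_n R n).
Local Notation v := (unit_ball_volume R n).
Implicit Types (x y : n.-tuple R) (r : R).

Lemma eucl_norm_ge0 x : (0 <= eucl_norm x)%R.
Proof. exact: sqrtr_ge0. Qed.

Lemma sqr_eucl_norm x : (eucl_norm x ^+ 2 = \sum_(i < n) tnth x i ^+ 2)%R.
Proof. by rewrite sqr_sqrtr// sumr_ge0// => i _; exact: sqr_ge0. Qed.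

Lemma eucl_norm_eq0 x : (eucl_norm x == 0%R) = [forall i, tnth x i == 0%R].
Proof.
have -> : (eucl_norm x == 0%R) = (eucl_norm x ^+ 2 == 0)%R by rewrite expf_eq0.
rewrite sqr_eucl_norm psumr_eq0; last by move=> i _; exact: sqr_ge0.
apply/allP/forallP => h i; last by rewrite /= expf_eq0 h.
by have /= := h i (mem_index_enum i); rewrite expf_eq0.
Qed.

(** With [a = |x|] and [b = |y|], the sum over [i] of
    [a b (x_i - y_i)^2 <= b (a + b) x_i^2 + a (a + b) y_i^2] is the claim
    multiplied by [a b]; the difference of the two sides is the square of
    [b x_i + a y_i]. *)
Lemma eucl_norm_sub_le x y :
  (eucl_norm (tuple_sub x y) <= eucl_norm x + eucl_norm y)%R.
Proof.
have ab_ge0 := addr_ge0 (eucl_norm_ge0 x) (eucl_norm_ge0 y).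
suff : (eucl_norm (tuple_sub x y) ^+ 2 <= (eucl_norm x + eucl_norm y) ^+ 2)%R.
  by rewrite ler_sqr ?nnegrE// eucl_norm_ge0.
have [a0|a_neq0] := eqVneq (eucl_norm x) 0%R.
  rewrite a0 add0r !sqr_eucl_norm.
  rewrite le_eqVlt; apply/orP; left; apply/eqP; apply: eq_bigr => i _.
  move/eqP: a0; rewrite eucl_norm_eq0 => /forallP/(_ i)/eqP xi.
  by rewrite tnth_mktuple xi sub0r sqrrN.
have [b0|b_neq0] := eqVneq (eucl_norm y) 0%R.
  rewrite b0 addr0 !sqr_eucl_norm.
  rewrite le_eqVlt; apply/orP; left; apply/eqP; apply: eq_bigr => i _.
  move/eqP: b0; rewrite eucl_norm_eq0 => /forallP/(_ i)/eqP yi.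
  by rewrite tnth_mktuple yi subr0.
set a := eucl_norm x; set b := eucl_norm y.
have a_gt0 : (0 < a)%R by rewrite lt_def a_neq0 eucl_norm_ge0.
have b_gt0 : (0 < b)%R by rewrite lt_def b_neq0 eucl_norm_ge0.
rewrite -(ler_pM2l (mulr_gt0 a_gt0 b_gt0)).
have -> : (a * b * (a + b) ^+ 2 = \sum_(i < n)
    (b * (a + b) * tnth x i ^+ 2 + a * (a + b) * tnth y i ^+ 2))%R.
  by rewrite big_split/= -!mulr_sumr -!sqr_eucl_norm -/a -/b; ring.
rewrite sqr_eucl_norm mulr_sumr; apply: ler_sum => i _; rewrite tnth_mktuple.
have := sqr_ge0 (b * tnth x i + a * tnth y i)%R.
by nra.
Qed.

Lemma tuple_subK x y : tuple_sub x (tuple_sub x y) = y.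
Proof. by apply: eq_from_tnth => i; rewrite !tnth_mktuple subKr. Qed.

Lemma measurable_eucl_norm : measurable_fun setT (@eucl_norm R n).
Proof.
rewrite (_ : @eucl_norm R n =
    fun x => (\sum_(i < n) tnth x i ^+ 2) `^ (2^-1))%R; last first.
  apply/funext => x.
  by rewrite powR12_sqrt// sumr_ge0// => i _; exact: sqr_ge0.
apply: (measurableT_comp (measurable_powR _)).
apply: measurable_sum => i; apply: measurable_funX; exact: measurable_tnth.
Qed.

Definition eucl_ball r : set (n.-tuple R) := [set x | (eucl_norm x <= r)%R].

Lemma measurable_eucl_ball r : measurable (eucl_ball r).
Proof.
rewrite -[X in measurable X]setTI.
rewrite (_ : eucl_ball r = @eucl_norm R n @^-1` `]-oo, r]%classic).
  by apply: measurable_eucl_norm => //; exact: measurable_itv.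
by apply/seteqP; split => x /=; rewrite in_itv.
Qed.

Lemma eucl_norm_scale a x :
  (eucl_norm (tuple_affine a [tuple 0 | i < n] x) = `|a| * eucl_norm x)%R.
Proof.
rewrite -sqrtr_sqr /eucl_norm -sqrtrM ?sqr_ge0// mulr_sumr; congr Num.sqrt.
by apply: eq_bigr => i _; rewrite !tnth_mktuple addr0 exprMn.
Qed.

Lemma lebesgue_n_eucl_ball r : (0 < r)%R ->
  mu (eucl_ball r) = (r ^+ n)%R%:E * v.
Proof.
move=> r0; rewrite -(@lebesgue_n_affine _ _ r [tuple 0%R | i < n]) ?gt_eqF//;
  last exact: measurable_eucl_ball.
rewrite gtr0_norm//; congr (_ * mu _); apply/seteqP; split => x;
  by rewrite /preimage /eucl_ball /= eucl_norm_scale gtr0_norm// ger_pMr.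
Qed.

Lemma prode_const (c : R) : \prod_(i < n) c%:E = (c ^+ n)%R%:E.
Proof.
by rewrite -(big_morph EFin (@EFinM R) erefl) prodr_const card_ord.
Qed.

(** The unit ball is contained in the cube [[-1, 1]^n]. *)
Lemma unit_ball_volume_lty : v < +oo.
Proof.
have mI : measurable (`[(-1)%R, 1%R]%classic : set R) by exact: measurable_itv.
apply: (@le_lt_trans _ _
  (mu [set x | forall i, `[(-1)%R, 1%R]%classic (tnth x i)])).
  apply: le_measure; rewrite ?inE;
    [exact: measurable_eucl_ball|exact: (@measurable_box _ _ (fun=> _))|].
  move=> x /= x1 i; rewrite in_itv /= -ler_norml.
  rewrite -(@ler_sqr _ _ 1%R) ?nnegrE// expr1n real_normK ?num_real//.
  have : (eucl_norm x ^+ 2 <= 1)%R by rewrite expr_le1// eucl_norm_ge0.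
  apply: le_trans; rewrite sqr_eucl_norm (bigD1 i)//= lerDl.
  by rewrite sumr_ge0// => j _; exact: sqr_ge0.
rewrite (@lebesgue_n_box _ _ (fun=> _))//.
rewrite lebesgue_measure_itv/= lte_fin ifT; last by lra.
by rewrite -EFinB prode_const ltry.
Qed.

(** The unit ball contains the cube [[0, 1/n]^n]. *)
Lemma unit_ball_volume_gt0 : (0 < n)%N -> 0 < v.
Proof.
move=> n0; have n0' : (0 < n%:R :> R)%R by rewrite ltr0n.
have mI : measurable (`[0%R, n%:R^-1%R]%classic : set R).
  exact: measurable_itv.
apply: (@lt_le_trans _ _
  (mu [set x | forall i, `[0%R, n%:R^-1%R]%classic (tnth x i)])).
  rewrite (@lebesgue_n_box _ _ (fun=> _))//.
  rewrite lebesgue_measure_itv/= lte_fin invr_gt0 n0'.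
  by rewrite sube0 prode_const lte_fin exprn_gt0// invr_gt0.
apply: le_measure; rewrite ?inE;
  [exact: (@measurable_box _ _ (fun=> _))|exact: measurable_eucl_ball|].
move=> x /= xn; rewrite /eucl_ball /= -(@ler_sqr _ _ 1%R) ?nnegrE
  ?eucl_norm_ge0// expr1n sqr_eucl_norm.
apply: (@le_trans _ _ (\sum_(i < n) n%:R^-1)%R).
  apply: ler_sum => i _; move: (xn i); rewrite in_itv/= => /andP[x0 x1].
  have n1 : (n%:R^-1 <= 1 :> R)%R by rewrite invf_le1// ler1n.
  by rewrite expr2; nra.
by rewrite sumr_const card_ord -[leLHS]mulr_natl divff// gt_eqF.
Qed.

Lemma fine_unit_ball_volume_gt0 : (0 < n)%N -> (0 < fine v)%R.
Proof. by move=> n0; rewrite fine_gt0// unit_ball_volume_gt0//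
  unit_ball_volume_lty. Qed.

Lemma fineK_unit_ball_volume : (fine v)%:E = v.
Proof.
by rewrite fineK// ge0_fin_numE ?measure_ge0//; exact: unit_ball_volume_lty.
Qed.

Lemma measurable_eucl_norm0 : measurable [set x : n.-tuple R | eucl_norm x = 0%R].
Proof.
rewrite -[X in measurable X]setTI.
exact: (measurable_eucl_norm measurableT (measurable_set1 (0%R : R))).
Qed.

Lemma lebesgue_n_eucl_norm0 :
  (0 < n)%N -> mu [set x : n.-tuple R | eucl_norm x = 0%R] = 0.
Proof.
move=> n0.
have -> : [set x : n.-tuple R | eucl_norm x = 0%R] =
    [set x | forall i, [set 0%R] (tnth x i)].
  apply/seteqP; split => x /=.
    by move=> /eqP; rewrite eucl_norm_eq0 => /forallP + i => /(_ i)/eqP.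
  by move=> x0; apply/eqP; rewrite eucl_norm_eq0; apply/forallP => i; apply/eqP.
rewrite (@lebesgue_n_box _ _ (fun=> _))// lebesgue_measure_set1 prode_const.
by rewrite expr0n gtn_eqF.
Qed.

End euclidean_balls.

(** * Layer cake formula and power integrals *)

Lemma powRN_cvgy0 (R : realType) (c : R) : (0 < c)%R ->
  (t `^ (- c))%R @[t --> +oo%R] --> (0 : R)%R.
Proof.
move=> c0; apply/cvgr0Pnorm_lt => e e0; near=> t.
have t0 : (0 < t)%R by near: t; exact: nbhs_pinfty_gt.
have te : (e `^ (- c^-1) < t)%R.
  by near: t; apply: nbhs_pinfty_gt; rewrite num_real.
rewrite ger0_norm ?powR_ge0// powRN invf_plt ?posrE ?powR_gt0//.
rewrite (_ : e^-1%R = (e `^ (- c^-1)) `^ c)%R; last first.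
  by rewrite -powRrM mulNr mulVf ?gt_eqF// powR_inv1// ltW.
by rewrite gt0_ltr_powR// nnegrE ?powR_ge0// ltW.
Unshelve. all: by end_near. Qed.

Lemma integral_powRN (R : realType) (c l : R) : (0 < c)%R -> (0 < l)%R ->
  \int[lebesgue_measure]_(t in `[l, +oo[) (t `^ (- c - 1))%R%:E =
  (l `^ (- c) / c)%R%:E.
Proof.
move=> c0 l0; have c0' : c != 0%R by rewrite gt_eqF.
pose F (t : R) : R := ((- c^-1) * t `^ (- c))%R.
have dF (x : R) : (0 < x)%R -> is_derive x 1%R F (x `^ (- c - 1))%R.
  move=> x0; have h := is_derive1_powR (- c)%R x0.
  have -> : (x `^ (- c - 1) = (- c^-1) *: (- c * x `^ (- c - 1)))%R.
    by rewrite /GRing.scale /= mulrA mulrNN mulVf// mul1r.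
  exact: is_deriveZ.
rewrite (@ge0_continuous_FTC2y _ _ F l 0%R).
- by rewrite -EFinB; congr EFin; rewrite /F sub0r mulNr opprK mulrC.
- by move=> x _; exact: powR_ge0.
- apply: derivable_within_continuous => x; rewrite in_itv/= andbT => lx.
  apply: derivable_powR; rewrite in_itv/= andbT; exact: lt_le_trans lx.
- rewrite -[X in _ --> X](mulr0 (- c^-1)%R); apply: cvgMr; exact: powRN_cvgy0.
- by move=> x lx; have [] := dF x (lt_trans l0 lx).
- apply: cvg_at_right_filter.
  have /derivable1_diffP/differentiable_continuous : derivable F l 1.
    by have [] := dF l l0.
  exact.
- move=> x; rewrite in_itv/= andbT => lx; rewrite derive1E.
  by have [_ ->] := dF x (lt_trans l0 lx).
Qed.

(** [(g x - l)^+] is the length of the section at [x] of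
    [{(x, t) | l <= t <= g x}]; exchange the integrals. *)
Lemma integral_truncated_layer_cake d (T : measurableType d) (R : realType)
    (m : {sigma_finite_measure set T -> \bar R}) (g : T -> R) (l : R) :
  measurable_fun setT g ->
  \int[m]_x (Num.max (g x - l) 0)%R%:E =
  \int[lebesgue_measure]_(t in `[l, +oo[) m [set x | (t <= g x)%R].
Proof.
move=> mg.
pose D : set (T * measurableTypeR R) :=
  [set q | (l <= q.2)%R && (q.2 <= g q.1)%R].
have DE q : (q \in D) = (l <= q.2)%R && (q.2 <= g q.1)%R by rewrite mem_setE.
have mD : measurable D.
  have m1 : measurable_fun setT
      (fun q : T * measurableTypeR R => (l <= q.2)%R && (q.2 <= g q.1)%R).
    apply: measurable_and; apply: measurable_fun_ler => //.
    exact: measurableT_comp.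
  by rewrite -[D]setTI; exact: (m1 measurableT [set true]).
transitivity (\int[m]_x \int[lebesgue_measure]_t (\1_D (x, t))%:E).
  apply: eq_integral => x _.
  rewrite (_ : (fun t => _) =
      (fun t => (\1_(`[l, g x]%classic : set R) t)%:E)); last first.
    by apply/funext => t; rewrite !indicE; congr (_%:R%:E).
  rewrite integral_indic//= setIT lebesgue_measure_itv /= lte_fin.
  case: ltP => [lg|gl]; first by rewrite max_l// subr_ge0 ltW.
  by rewrite max_r// subr_le0.
rewrite (fubini_tonelli (fun q => (\1_D q)%:E))//; last first.
  exact/measurable_EFinP/measurable_indic.
rewrite [RHS]integral_mkcond; apply: eq_integral => t _.
rewrite patchE; case: ifPn => [|] tl.
  rewrite (_ : (fun x => _) =
      (fun x => (\1_[set x | (t <= g x)%R] x)%:E)); last first.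
    apply/funext => x; rewrite !indicE; congr (_%:R%:E).
    rewrite DE mem_setE /=.
    by move: tl; rewrite mem_setE /= in_itv /= andbT => ->.
  rewrite integral_indic ?setIT//.
  have mt : measurable_fun setT (fun x => (t <= g x)%R).
    exact: measurable_fun_ler.
  by rewrite -[X in measurable X]setTI; exact: (mt measurableT [set true]).
rewrite integral0_eq// => x _; rewrite indicE DE /=.
by move: tl; rewrite mem_setE /= in_itv /= andbT => /negbTE ->.
Qed.

(** * The kernel of the Riesz potential *)

Section riesz_kernel.
Context (R : realType) (n : nat) (s : R).
Local Notation mu := (lebesgue_n R n).
Local Notation v := (unit_ball_volume R n).
Local Notation p := (n%:R - s)%R.

(** At the origin the inverse of [0] gives the kernel the value [0], so that its
    superlevel sets are punctured balls. *)
Definition riesz_kernel (y : n.-tuple R) : R :=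
  ((eucl_norm y `^ (n%:R - s))^-1)%R.

Lemma riesz_kernel_ge0 y : (0 <= riesz_kernel y)%R.
Proof. by rewrite invr_ge0 powR_ge0. Qed.

Lemma measurable_riesz_kernel : measurable_fun setT riesz_kernel.
Proof.
rewrite (_ : riesz_kernel = fun y => eucl_norm y `^ (- p))%R; last first.
  by apply/funext => y; rewrite powRN.
exact: (measurableT_comp (measurable_powR _) (@measurable_eucl_norm R n)).
Qed.

Lemma measurable_riesz_kernel_superlevel (t : R) :
  measurable [set y | (t <= riesz_kernel y)%R].
Proof.
have mt : measurable_fun setT (fun y => (t <= riesz_kernel y)%R).
  by apply: measurable_fun_ler => //; exact: measurable_riesz_kernel.
by rewrite -[X in measurable X]setTI; exact: (mt measurableT [set true]).
Qed.

Hypotheses (s0 : (0 < s)%R) (sn : (s < n%:R)%R).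

Let n0 : (0 < n)%N.
Proof. by rewrite -(ltr0n R) (lt_trans s0). Qed.

Let p0 : (0 < p)%R.
Proof. by rewrite subr_gt0. Qed.

Lemma riesz_kernel_superlevelE (t : R) : (0 < t)%R ->
  [set y | (t <= riesz_kernel y)%R] =
  @eucl_ball R n (t `^ (- p^-1)) `\` [set y | eucl_norm y = 0%R].
Proof.
move=> t0; apply/seteqP; split => y; rewrite /eucl_ball /riesz_kernel /=.
  have [->|y0 ty] := eqVneq (eucl_norm y) 0%R.
    by rewrite powR0 ?gt_eqF// invr0 leNgt t0.
  have y_gt0 : (0 < eucl_norm y)%R by rewrite lt_def y0 eucl_norm_ge0.
  split; last exact/eqP.
  have : (t `^ (- p^-1) >= (eucl_norm y `^ (- p)) `^ (- p^-1))%R.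
    rewrite !powRN lef_pV2 ?posrE ?powR_gt0// ?powRN ?invr_gt0 ?powR_gt0//.
    rewrite ge0_ler_powR ?invr_ge0 ?nnegrE ?(ltW t0) ?(ltW p0)//.
    by rewrite invr_ge0 powR_ge0.
  by rewrite -powRrM mulrNN divff ?gt_eqF// powRr1// ltW.
move=> [yt /eqP y0].
have y_gt0 : (0 < eucl_norm y)%R by rewrite lt_def y0 eucl_norm_ge0.
rewrite -[leLHS]invrK lef_pV2 ?posrE ?invr_gt0 ?powR_gt0//.
have -> : (t^-1 = (t `^ (- p^-1)) `^ p)%R.
  by rewrite -powRrM mulNr mulVf ?gt_eqF// powR_inv1// ltW.
by rewrite ge0_ler_powR// ?nnegrE ?powR_ge0// ltW.
Qed.

Lemma lebesgue_n_riesz_kernel_superlevel (t : R) : (0 < t)%R ->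
  mu [set y | (t <= riesz_kernel y)%R] = (t `^ (- (n%:R / p)))%R%:E * v.
Proof.
move=> t0; rewrite riesz_kernel_superlevelE//.
have mZ := @measurable_eucl_norm0 R n.
have mB := @measurable_eucl_ball R n (t `^ (- p^-1))%R.
have r0 : (0 < t `^ (- p^-1))%R by rewrite powR_gt0.
have bE : mu (@eucl_ball R n (t `^ (- p^-1))%R) =
    (t `^ (- (n%:R / p)))%R%:E * v.
  rewrite lebesgue_n_eucl_ball//; congr (_%:E * _).
  rewrite -powR_mulrn ?powR_ge0// -powRrM; congr (_ `^ _)%R.
  by rewrite mulNr mulrC.
have boo : mu (@eucl_ball R n (t `^ (- p^-1))%R) < +oo.
  by rewrite bE lte_mul_pinfty// ?lee_fin ?powR_ge0// unit_ball_volume_lty.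
have mBZ : mu (@eucl_ball R n (t `^ (- p^-1))%R `&`
               [set y | eucl_norm y = 0%R]) = 0.
  apply/eqP; rewrite eq_le measure_ge0 andbT -(lebesgue_n_eucl_norm0 R n0).
  by apply: le_measure; rewrite ?inE//; exact: measurableI.
by rewrite -bE -[RHS]sube0 -mBZ; exact: measureD.
Qed.

Lemma integral_riesz_kernel_tail (l : R) : (0 < l)%R ->
  \int[mu]_y (Num.max (riesz_kernel y - l) 0)%R%:E =
  (l `^ (- (s / p)) * (p / s))%R%:E * v.
Proof.
move=> l0.
rewrite integral_truncated_layer_cake; last exact: measurable_riesz_kernel.
have sp0 : (0 < s / p)%R by rewrite divr_gt0.
transitivity (\int[lebesgue_measure]_(t in `[l, +oo[)
    (v * (t `^ (- (s / p) - 1))%R%:E)).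
  apply: eq_integral => t; rewrite mem_setE in_itv/= andbT => lt.
  rewrite lebesgue_n_riesz_kernel_superlevel; last exact: lt_le_trans lt.
  rewrite muleC; congr (_ * (_ `^ _)%R%:E).
  by field; rewrite gt_eqF.
rewrite ge0_integralZl//; last 2 first.
- apply/measurable_EFinP/measurable_funTS; exact: measurable_powR.
- by move=> t _; rewrite lee_fin powR_ge0.
rewrite integral_powRN// muleC; congr (_%:E * _).
by rewrite invf_div.
Qed.

(** On its superlevel set the kernel is [l] plus its tail, and the tail
    vanishes elsewhere. *)
Lemma integral_riesz_kernel_superlevel (l : R) : (0 < l)%R ->
  \int[mu]_(y in [set y | (l <= riesz_kernel y)%R]) (riesz_kernel y)%:E =
  (l `^ (- (s / p)) * (n%:R / s))%R%:E * v.
Proof.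
move=> l0; rewrite integral_mkcond.
have mA := measurable_riesz_kernel_superlevel l.
transitivity (\int[mu]_y
    (l%:E * (\1_[set y | (l <= riesz_kernel y)%R] y)%:E +
    (Num.max (riesz_kernel y - l) 0)%R%:E)).
  apply: eq_integral => y _; rewrite patchE indicE !mem_setE.
  case: ifPn => [ly|]; last rewrite -ltNge => yl.
    by rewrite mule1 -EFinD max_l ?subr_ge0// addrC subrK.
  by rewrite mule0 add0e max_r// subr_le0 ltW.
have mK := measurable_riesz_kernel.
rewrite ge0_integralD//; last 4 first.
- by move=> y _; rewrite mule_ge0// lee_fin// ltW.
- by apply: measurable_funeM; apply/measurable_EFinP/measurable_indic.
- by move=> y _; rewrite lee_fin le_max lexx orbT.
- apply/measurable_EFinP; apply: measurable_maxr => //.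
  exact: measurable_funB.
rewrite integral_riesz_kernel_tail// ge0_integralZl//; last 2 first.
- by apply/measurable_EFinP/measurable_indic.
- by rewrite lee_fin ltW.
rewrite integral_indic// setIT -[X in l%:E * X]/(mu _).
rewrite lebesgue_n_riesz_kernel_superlevel//.
rewrite muleA -EFinM -[LHS]ge0_muleDl ?lee_fin ?mulr_ge0 ?powR_ge0
  ?invr_ge0 ?(ltW l0) ?(ltW p0) ?(ltW s0)//.
congr (_%:E * _).
have -> : (- (n%:R / p) = - (s / p) - 1)%R by field; rewrite gt_eqF.
rewrite [X in (l * X)%R]powRD; last by rewrite (gt_eqF l0) implybT.
rewrite powR_inv1; last exact: ltW.
by field; rewrite ?gt_eqF.
Qed.

End riesz_kernel.

(** * Convolutions and the Riesz potential *)

Section riesz_potential_facts.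
Context (R : realType) (n : nat) (s : R).
Local Notation mu := (lebesgue_n R n).

Lemma riesz_const_ge0 : (0 <= riesz_const n s)%R.
Proof.
have Gamma_ge0 (a : R) : (0 <= Gamma a)%R.
  by apply: Rintegral_ge0 => t _; rewrite mulr_ge0 ?powR_ge0 ?expR_ge0.
by rewrite !mulr_ge0 ?invr_ge0 ?powR_ge0.
Qed.

Let measurable_conv_integrand (f g : n.-tuple R -> R) :
  measurable_fun setT f -> measurable_fun setT g ->
  measurable_fun setT (fun q : n.-tuple R * n.-tuple R =>
    (f (tuple_sub q.1 q.2) * g q.2)%R%:E).
Proof.
move=> mf mg; apply/measurable_EFinP; apply: measurable_funM.
  exact: (measurableT_comp mf (@measurable_tuple_sub R n)).
exact: measurableT_comp.
Qed.

Lemma measurable_integral_conv (f g : n.-tuple R -> R) :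
  measurable_fun setT f -> measurable_fun setT g ->
  measurable_fun setT (fun x => \int[mu]_y (f (tuple_sub x y) * g y)%R%:E).
Proof.
move=> mf mg; have mh := measurable_conv_integrand mf mg.
set h := fun _ => _ in mh.
under eq_fun do rewrite integralE.
apply: emeasurable_funB.
- rewrite (_ : (fun x => _) = fubini_F mu h^\+); last first.
    by apply/funext => x; apply: eq_integral => y _; rewrite !funeposE.
  by apply: measurable_fun_fubini_tonelli_F => //; exact: measurable_funepos.
- rewrite (_ : (fun x => _) = fubini_F mu h^\-); last first.
    by apply/funext => x; apply: eq_integral => y _; rewrite !funenegE.
  by apply: measurable_fun_fubini_tonelli_F => //; exact: measurable_funeneg.
Qed.

Lemma measurable_riesz_potential (f : n.-tuple R -> R) :
  measurable_fun setT f -> measurable_fun setT (riesz_potential s f).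
Proof.
move=> mf; apply: measurable_funeM.
apply: measurable_integral_conv => //; exact: (@measurable_riesz_kernel R n s).
Qed.

Lemma measurable_riesz_potential_gt (f : n.-tuple R -> R) (l : R) :
  measurable_fun setT f ->
  measurable [set x | l%:E < `|riesz_potential s f x|].
Proof.
move=> mf; rewrite -[X in measurable X]setTI; apply: measurable_lte => //.
by apply: measurableT_comp => //; exact: measurable_riesz_potential.
Qed.

Lemma integral_conv (f g : n.-tuple R -> R) :
  measurable_fun setT f -> (forall x, 0 <= f x)%R ->
  measurable_fun setT g -> (forall x, 0 <= g x)%R ->
  \int[mu]_x \int[mu]_y (f (tuple_sub x y) * g y)%R%:E =
  (\int[mu]_x (f x)%:E) * (\int[mu]_y (g y)%:E).
Proof.
move=> mf f0 mg g0; have mh := measurable_conv_integrand mf mg.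
rewrite (fubini_tonelli _ mh)//; last by move=> q; rewrite lee_fin mulr_ge0.
rewrite -ge0_integralZl//; last 3 first.
- exact/measurable_EFinP.
- by move=> y _; rewrite lee_fin.
- by apply: integral_ge0 => x _; rewrite lee_fin.
apply: eq_integral => y _.
transitivity (\int[mu]_x ((g y)%:E * (f (tuple_sub x y))%:E)).
  by apply: eq_integral => x _; rewrite /= EFinM muleC.
rewrite ge0_integralZl//; last 3 first.
- apply/measurable_EFinP; apply: (measurableT_comp mf).
  exact: measurable_tuple_subr.
- by move=> x _; rewrite lee_fin.
- by rewrite lee_fin.
rewrite (ge0_integral_subr y (f := EFin \o f))//; first by rewrite muleC.
exact/measurable_EFinP.
Qed.

End riesz_potential_facts.

(** * Upper bound *)

Section upper_bound.
Context (R : realType) (n : nat) (s : R).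
Local Notation mu := (lebesgue_n R n).
Local Notation v := (unit_ball_volume R n).
Local Notation p := (n%:R - s)%R.
Local Notation K := (@riesz_kernel R n s).
Local Notation H l := (fun y => Num.max (K y - l) 0)%R.

(** Integrate [K <= l + (K - l)^+] against [|f (x - y)|]. *)
Lemma abse_riesz_potential_le (f : n.-tuple R -> R) (l : R) x : (0 < l)%R ->
  measurable_fun setT f ->
  `| riesz_potential s f x | <= (riesz_const n s)%:E *
    (l%:E * \int[mu]_x `|f x|%R%:E +
     \int[mu]_y (`|f (tuple_sub x y)| * H l y)%R%:E).
Proof.
move=> l0 mf; have g0 := riesz_const_ge0 n s.
have mK := @measurable_riesz_kernel R n s.
have mH : measurable_fun setT (H l).
  by apply: measurable_maxr => //; exact: measurable_funB.
have mfx : measurable_fun setT (fun y => f (tuple_sub x y)).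
  exact: (measurableT_comp mf (measurable_tuple_subl x)).
rewrite abseM gee0_abs ?lee_fin//; apply: lee_wpmul2l; first by rewrite lee_fin.
have mfK : measurable_fun setT
    (fun y => (f (tuple_sub x y) / eucl_norm y `^ p)%R%:E).
  by apply/measurable_EFinP; exact: measurable_funM.
apply: (le_trans (le_abse_integral mu measurableT mfK)).
have mabs : measurable_fun setT (fun y => `|f (tuple_sub x y)|%R).
  exact: measurableT_comp.
rewrite -(ge0_integral_subl x (f := fun y => `|f y|%R%:E))//; last first.
  by apply/measurable_EFinP; exact: measurableT_comp.
rewrite -ge0_integralZl//; last 2 first.
- exact/measurable_EFinP.
- by rewrite lee_fin ltW.
rewrite -ge0_integralD//; last 4 first.
- by move=> y _; rewrite mule_ge0// lee_fin// ltW.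
- by apply: measurable_funeM; exact/measurable_EFinP.
- by move=> y _; rewrite lee_fin mulr_ge0// le_max lexx orbT.
- by apply/measurable_EFinP; exact: measurable_funM.
apply: ge0_le_integral => //.
- exact: measurableT_comp.
- apply: emeasurable_funD.
    by apply: measurable_funeM; exact/measurable_EFinP.
  by apply/measurable_EFinP; exact: measurable_funM.
move=> y _; rewrite -EFinM -EFinD lee_fin normrM.
rewrite (ger0_norm (riesz_kernel_ge0 s y)) [(l * _)%R]mulrC -mulrDr.
by rewrite ler_wpM2l// -lerBlDl le_max lexx.
Qed.

Hypotheses (s0 : (0 < s)%R) (sn : (s < n%:R)%R).

(** Where [|I_s f| > l], the convolution [G] of [|f|] with the tail of the
    kernel above [c] satisfies [g G >= l p / n]; Chebyshev's inequality for [G]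
    bounds the measure of this set by [c^(-n/p) v]. *)
Lemma weak_norm_riesz_potential_le (f : n.-tuple R -> R) (N : R) : (0 < N)%R ->
  measurable_fun setT f -> \int[mu]_x `|f x|%R%:E = N%:E ->
  weak_norm s (riesz_potential s f) <=
  (riesz_const n s)%:E * v `^ (p / n%:R) * (n%:R / s)%R%:E * N%:E.
Proof.
move=> N0 mf fN; set g := riesz_const n s.
have n0 : (0 < n%:R :> R)%R by exact: lt_trans sn.
have p0 : (0 < p)%R by rewrite subr_gt0.
apply: ge_ereal_sup => _ [l /= l0 <-].
have mE := measurable_riesz_potential_gt s l mf.
set E := [set x | _] in mE *.
have [g0|g_neq0] := eqVneq g 0%R.
  rewrite (_ : E = set0); last first.
    apply/seteqP; split => x //=.
    by rewrite /E /= /riesz_potential -/g g0 mul0e abse0 lte_fin ltNge (ltW l0).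
  rewrite measure0 poweR0r ?mule0 ?g0 ?mul0e//.
  by rewrite mulf_neq0 ?invr_neq0// gt_eqF.
have g0 : (0 < g)%R by rewrite lt_def g_neq0 riesz_const_ge0.
pose a := (g * N)%R; have a0 : (0 < a)%R by rewrite mulr_gt0.
(* The height that minimizes the bound a c^(-s/p) / (l - a c) on |E|. *)
pose c := (s * l / (n%:R * a))%R.
have c0 : (0 < c)%R by rewrite divr_gt0// mulr_gt0.
have mK := @measurable_riesz_kernel R n s.
have mH : measurable_fun setT (H c).
  by apply: measurable_maxr => //; exact: measurable_funB.
have mabsf : measurable_fun setT (fun x => `|f x|%R) by exact: measurableT_comp.
have H0 y : (0 <= H c y)%R by rewrite le_max lexx orbT.
have w0 : (0 < fine v)%R by apply: fine_unit_ball_volume_gt0; rewrite -(ltr0n R).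
rewrite -(fineK_unit_ball_volume R n); set w := fine v in w0 *.
pose G x := \int[mu]_y (`|f (tuple_sub x y)| * H c y)%R%:E.
have mG : measurable_fun setT G.
  exact: (measurable_integral_conv mabsf mH).
have G0 x : 0 <= G x by apply: integral_ge0 => y _; rewrite lee_fin mulr_ge0.
have intG : \int[mu]_x G x = (N * (c `^ (- (s / p)) * (p / s) * w))%R%:E.
  rewrite (integral_conv (f := fun x => `|f x|%R) (g := H c))// fN.
  rewrite (integral_riesz_kernel_tail s0 sn c0) -(fineK_unit_ball_volume R n).
  by rewrite -!EFinM.
have lp0 : (0 < l * (p / n%:R))%R by rewrite mulr_gt0// divr_gt0.
have GE x : E x -> (l * (p / n%:R))%R%:E <= g%:E * G x.
  move=> /= Ex; have := lt_le_trans Ex (abse_riesz_potential_le x c0 mf).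
  rewrite fN -/g -/(G x) ge0_muleDr// ?mule_ge0 ?lee_fin ?(ltW c0) ?(ltW N0)//.
  move=> /ltW; rewrite -!EFinM -leeBlDl// -EFinB; apply: le_trans.
  rewrite lee_fin le_eqVlt; apply/orP; left; apply/eqP.
  rewrite /c /a; field.
  by rewrite ?gt_eqF.
have Eub : (l * (p / n%:R))%R%:E * mu E <=
    (g * (N * (c `^ (- (s / p)) * (p / s) * w)))%R%:E.
  rewrite [leRHS]EFinM -intG -ge0_integralZl//; last by rewrite lee_fin ltW.
  rewrite -[E]setIT -integral_indic// -ge0_integralZl//; last 2 first.
  - exact/measurable_EFinP/measurable_indic.
  - by rewrite lee_fin ltW.
  apply: ge0_le_integral => //.
  - by move=> x _; rewrite mule_ge0// lee_fin// ltW.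
  - by apply: measurable_funeM; exact/measurable_EFinP/measurable_indic.
  - exact: measurable_funeM.
  move=> x _; rewrite indicE; case: (boolP (x \in E)) => [/set_mem Ex|_].
    by rewrite mule1; exact: GE.
  by rewrite mule0 mule_ge0// lee_fin ltW.
have {}Eub : mu E <= (c `^ (- (n%:R / p)) * w)%R%:E.
  rewrite -(@lee_pmul2l _ (l * (p / n%:R))%R%:E)//.
  apply: (le_trans Eub); rewrite -EFinM lee_fin.
  rewrite le_eqVlt; apply/orP; left; apply/eqP.
  have -> : (- (n%:R / p) = - (s / p) - 1)%R by field; rewrite gt_eqF.
  rewrite [in RHS]powRD; last by rewrite (gt_eqF c0) implybT.
  rewrite powR_inv1; last exact: ltW.
  set C := (c `^ _)%R; rewrite /c /a; field.
  by rewrite ?gt_eqF.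
apply: (@le_trans _ _
  (l%:E * ((c `^ (- (n%:R / p)) * w)%R%:E `^ (p / n%:R)))).
  rewrite lee_pmul2l// gt0_ler_poweR//.
  - by rewrite divr_ge0// ltW.
  - by rewrite in_itv /= measure_ge0 leey.
  - by rewrite in_itv /= leey andbT lee_fin mulr_ge0 ?powR_ge0 ?ltW.
rewrite !poweR_EFin -!EFinM lee_fin powRM ?powR_ge0 ?(ltW w0)// -powRrM.
rewrite (_ : - (n%:R / p) * (p / n%:R) = -1)%R; last by field; rewrite ?gt_eqF.
rewrite powR_inv1 ?(ltW c0)// le_eqVlt; apply/orP; left; apply/eqP.
rewrite /c /a; field.
by rewrite ?gt_eqF.
Qed.

Lemma best_const_le :
  best_const n s <= (riesz_const n s)%:E * v `^ (p / n%:R) * (n%:R / s)%R%:E.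
Proof.
apply: ge_ereal_sup => _ [f [/integrableP[/measurable_EFinP mf foo] fneq0] <-].
have N1 : 'N[mu]_1[EFin \o f] = \int[mu]_x `|f x|%R%:E by rewrite Lnorm1.
have N0 : 0 <= \int[mu]_x `|f x|%R%:E.
  by apply: integral_ge0 => x _; rewrite lee_fin.
have [N NE] : exists N, \int[mu]_x `|f x|%R%:E = N%:E.
  exists (fine (\int[mu]_x `|f x|%R%:E)).
  by rewrite fineK// ge0_fin_numE.
have N_gt0 : (0 < N)%R.
  rewrite lt_def -lee_fin -NE N0 andbT; apply: contra_notN fneq0 => /eqP N00.
  have /(ae_eq_integral_abs mu measurableT) : measurable_fun setT (EFin \o f).
    exact/measurable_EFinP.
  move=> [+ _]; rewrite -[X in X = 0 -> _]/(\int[mu]_x `|f x|%R%:E) NE N00.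
  move=> /(_ erefl).
  by apply: filterS => x /= /(_ Logic.I) [].
rewrite N1 NE inver gt_eqF// lee_pdivrMr//.
exact: weak_norm_riesz_potential_le.
Qed.

End upper_bound.

(** * Lower bound *)

Section lower_bound.
Context (R : realType) (n : nat) (s : R).
Hypotheses (s0 : (0 < s)%R) (sn : (s < n%:R)%R).
Local Notation mu := (lebesgue_n R n).
Local Notation v := (unit_ball_volume R n).
Local Notation p := (n%:R - s)%R.
Local Notation K := (@riesz_kernel R n s).
Local Notation B := (@eucl_ball R n 1%R).

Let n0 : (0 < n)%N.
Proof. by rewrite -(ltr0n R) (lt_trans s0). Qed.

Let p0 : (0 < p)%R.
Proof. by rewrite subr_gt0. Qed.

(** The test function is the indicator of the unit ball. *)
Lemma best_const_ge (t L : R) : (0 < t)%R -> (0 <= L)%R ->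
  (forall x, (eucl_norm x <= t)%R ->
    L%:E <= \int[mu]_y (\1_B (tuple_sub x y) * K y)%R%:E) ->
  (riesz_const n s * fine v `^ (p / n%:R) * (t `^ p * (L / fine v)))%R%:E
    <= best_const n s.
Proof.
move=> t0 L0 HL; have w0 := fine_unit_ball_volume_gt0 R n0.
have vE := fineK_unit_ball_volume R n.
set w := fine v in w0 vE *; set g := riesz_const n s.
have g_ge0 : (0 <= g)%R := riesz_const_ge0 n s.
have mB : measurable B by exact: measurable_eucl_ball.
have mf : measurable_fun setT (\1_B : n.-tuple R -> R).
  exact: measurable_indic.
have intf : \int[mu]_x `|(EFin \o \1_B) x| = v.
  transitivity (\int[mu]_x (\1_B x)%:E); last by rewrite integral_indic// setIT.
  by apply: eq_integral => x _; rewrite /= ger0_norm.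
have index : mu.-integrable setT (EFin \o (\1_B : n.-tuple R -> R)) /\
    ~ {ae mu, forall x, \1_B x = 0%R :> R}.
  split.
    apply/integrableP; split; first exact/measurable_EFinP.
    by rewrite intf unit_ball_volume_lty.
  move=> [N [mN N0 BN]]; have := unit_ball_volume_gt0 R n0.
  apply/negP; rewrite -leNgt -N0; apply: le_measure; rewrite ?inE//.
  move=> x Bx; apply: BN => /=; rewrite indicE mem_set// => /eqP.
  by rewrite oner_eq0.
apply: le_ereal_sup_tmp.
exists (weak_norm s (riesz_potential s \1_B) / 'N[mu]_1[EFin \o \1_B]).
  by exists \1_B.
rewrite Lnorm1 intf -vE inver gt_eqF// lee_pdivlMr// -EFinM.
have weak0 : 0 <= weak_norm s (riesz_potential s (\1_B : n.-tuple R -> R)).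
  apply: le_ereal_sup_tmp; eexists; first by exists 1%R => //=; exact: ltr01.
  by rewrite mule_ge0// poweR_ge0.
have [gL0|gL_neq0] := eqVneq (g * L)%R 0%R.
  apply: le_trans weak0; rewrite lee_fin.
  have -> : (g * w `^ (p / n%:R) * (t `^ p * (L / w)) * w =
      g * L * (w `^ (p / n%:R) * t `^ p))%R by field; rewrite gt_eqF.
  by rewrite gL0 mul0r.
have gL : (0 < g * L)%R by rewrite lt_def gL_neq0 mulr_ge0.
(* The level sets are strict: use the levels r g L for r < 1. *)
apply/lee_mul01Pr => [|r r01].
  have Lw : (0 <= L / w)%R by rewrite divr_ge0// ltW.
  rewrite lee_fin; apply: mulr_ge0 (ltW w0); apply: mulr_ge0.
    exact: mulr_ge0 g_ge0 (powR_ge0 _ _).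
  exact: mulr_ge0 (powR_ge0 _ _) Lw.
have /andP[r0 r1] := r01; have rgL : (0 < r * (g * L))%R by rewrite mulr_gt0.
have mE := measurable_riesz_potential_gt s (r * (g * L))%R mf.
set E := [set x | _] in mE.
apply: le_ereal_sup_tmp.
exists ((r * (g * L))%R%:E * mu E `^ (p / n%:R)).
  by exists (r * (g * L))%R.
have bE : mu (eucl_ball t) = (t ^+ n * w)%R%:E.
  by rewrite lebesgue_n_eucl_ball// EFinM vE.
have tE : (t ^+ n * w)%R%:E <= mu E.
  rewrite -bE; apply: le_measure; rewrite ?inE//.
    exact: measurable_eucl_ball.
  move=> x /= xt; rewrite /E /= /riesz_potential -/g.
  apply: (@lt_le_trans _ _ (g * L)%R%:E).
    by rewrite lte_fin gtr_pMl.
  rewrite EFinM gee0_abs ?lee_wpmul2l ?lee_fin//; first exact: HL.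
  apply: mule_ge0; rewrite ?lee_fin//; apply: integral_ge0 => y _.
  by rewrite lee_fin mulr_ge0// riesz_kernel_ge0.
have n0' : (0 < n%:R :> R)%R by rewrite ltr0n.
have pn0 : (0 <= p / n%:R)%R by rewrite divr_ge0 ?ltW.
apply: (@le_trans _ _
  ((r * (g * L))%R%:E * (t ^+ n * w)%R%:E `^ (p / n%:R))).
  rewrite poweR_EFin -!EFinM lee_fin le_eqVlt; apply/orP; left; apply/eqP.
  rewrite powRM ?exprn_ge0 ?(ltW t0) ?(ltW w0)//.
  rewrite -powR_mulrn ?(ltW t0)// -powRrM.
  rewrite (_ : n%:R * (p / n%:R) = p)%R; last by field; rewrite gt_eqF.
  by field; rewrite gt_eqF.
rewrite lee_pmul2l// gt0_ler_poweR//.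
- by rewrite in_itv /= leey andbT lee_fin mulr_ge0 ?exprn_ge0 ?ltW.
- by rewrite in_itv /= measure_ge0 leey.
Qed.

(** The right-hand side is at least the integral of the kernel over the ball of
    radius [r] around the origin, which is a superlevel set of the kernel up to
    the origin. *)
Lemma conv_kernel_ge_near (r : R) x : (0 < r)%R ->
  (eucl_norm x <= 1 - r)%R ->
  (r `^ s * (n%:R / s) * fine v)%R%:E <=
  \int[mu]_y (\1_B (tuple_sub x y) * K y)%R%:E.
Proof.
move=> r0 xr.
have l0 : (0 < r `^ (- p))%R by rewrite powR_gt0.
have -> : (r `^ s * (n%:R / s) * fine v)%R%:E =
    ((r `^ (- p)) `^ (- (s / p)) * (n%:R / s))%R%:E * v.
  rewrite -fineK_unit_ball_volume -EFinM -powRrM.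
  by congr (_ `^ _ * _ * _)%:E%R; field; rewrite gt_eqF.
have mK := @measurable_riesz_kernel R n s.
have mS := @measurable_riesz_kernel_superlevel R n s (r `^ (- p)).
rewrite -integral_riesz_kernel_superlevel// integral_mkcond.
apply: ge0_le_integral => //.
- move=> y _; rewrite patchE; case: ifP => // _.
  by rewrite lee_fin riesz_kernel_ge0.
- apply/(measurable_restrictT _ mS); apply/measurable_EFinP.
  exact: measurable_funTS.
- apply/measurable_EFinP; apply: measurable_funM => //.
  apply: (@measurableT_comp _ _ _ _ _ _ (\1_B : n.-tuple R -> R)).
    apply: measurable_indic; exact: measurable_eucl_ball.
  exact: measurable_tuple_subl.
move=> y _; rewrite patchE; case: ifPn => [/set_mem|_]; last first.
  by rewrite lee_fin mulr_ge0// riesz_kernel_ge0.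
rewrite riesz_kernel_superlevelE// => -[+ _].
rewrite /eucl_ball /= -powRrM mulrNN divff ?gt_eqF// powRr1 ?(ltW r0)// => yr.
rewrite indicE mem_set ?mul1r//=.
by rewrite (le_trans (eucl_norm_sub_le x y))// -(subrK r 1%R) lerD.
Qed.

(** On the unit ball around [x] the kernel is at least [(t + 1)^(-p)], except at
    the origin. *)
Lemma conv_kernel_ge_far (t : R) x : (0 < t)%R -> (eucl_norm x <= t)%R ->
  ((t + 1) `^ (- p) * fine v)%R%:E <=
  \int[mu]_y (\1_B (tuple_sub x y) * K y)%R%:E.
Proof.
move=> t0 xt.
have mK := @measurable_riesz_kernel R n s.
have mB : measurable B by exact: measurable_eucl_ball.
have mf : measurable_fun setT (\1_B : n.-tuple R -> R).
  exact: measurable_indic.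
have mfx : measurable_fun setT (fun y => \1_B (tuple_sub x y) : R).
  exact: (measurableT_comp mf (measurable_tuple_subl x)).
have -> : ((t + 1) `^ (- p) * fine v)%R%:E =
    \int[mu]_y (((t + 1) `^ (- p))%R%:E * (\1_B (tuple_sub x y))%:E).
  rewrite ge0_integralZl//; last 2 first.
  - exact/measurable_EFinP.
  - by rewrite lee_fin powR_ge0.
  rewrite (ge0_integral_subl x (f := EFin \o \1_B))//; last 2 first.
  - exact/measurable_EFinP.
  - by move=> y; rewrite lee_fin.
  by rewrite EFinM fineK_unit_ball_volume integral_indic// setIT.
apply: ae_ge0_le_integral => //.
- by move=> y _; rewrite mule_ge0// lee_fin powR_ge0.
- by apply: measurable_funeM; exact/measurable_EFinP.
- by move=> y _; rewrite lee_fin mulr_ge0// riesz_kernel_ge0.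
- by apply/measurable_EFinP; exact: measurable_funM.
exists [set y | eucl_norm y = 0%R]; split.
- exact: measurable_eucl_norm0.
- exact: lebesgue_n_eucl_norm0.
move=> y /=; apply: contra_notP => y0 _.
rewrite -EFinM lee_fin mulrC indicE.
case: (boolP (tuple_sub x y \in B)) => [|_]; last by rewrite !mul0r.
rewrite inE /eucl_ball /= => xy; rewrite !mul1r.
have t1 : (0 < t + 1)%R by rewrite addr_gt0.
have : [set y | ((t + 1) `^ (- p) <= K y)%R] y; last exact.
rewrite riesz_kernel_superlevelE ?powR_gt0//; split => //.
rewrite /eucl_ball /= -powRrM mulrNN divff ?gt_eqF// powRr1 ?(ltW t1)//.
by rewrite -[y in leLHS](tuple_subK x) (le_trans (eucl_norm_sub_le _ _))// lerD.
Qed.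

End lower_bound.

Lemma bernoulli_le (R : realFieldType) (x : R) (n : nat) :
  (0 <= x <= 1 -> 1 - n%:R * x <= (1 - x) ^+ n)%R.
Proof.
move=> /andP[x0 x1]; elim: n => [|n IH]; first by rewrite mul0r subr0 expr0.
have nx : (0 <= n%:R * x ^+ 2)%R by rewrite mulr_ge0// sqr_ge0.
rewrite exprS; apply: le_trans (_ : (1 - x) * (1 - n%:R * x) <= _)%R.
  by rewrite -natr1; nra.
by rewrite ler_wpM2l// subr_ge0.
Qed.

(** With [r = 1 / (2 n)], Bernoulli's inequality gives [(1 - r)^p >= 1/2], and
    [r^s >= r^(1/2) >= 1 / n]. *)
Lemma best_const_ge_near (R : realType) (n : nat) (s : R) :
  (1 < n)%N -> (0 < s < 2^-1)%R ->
  (riesz_const n s * fine (unit_ball_volume R n) `^ ((n%:R - s) / n%:R) *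
    (2 * s)^-1)%R%:E <= best_const n s.
Proof.
move=> n1 /andP[s0 s12].
have n2 : (2 <= n%:R :> R)%R by rewrite ler_nat.
have n0 : (0 < n%:R :> R)%R by lra.
have sn : (s < n%:R)%R by lra.
pose r := (n%:R * 2)^-1%R : R.
have r0 : (0 < r)%R by rewrite invr_gt0 mulr_gt0.
have nr : (n%:R * r = 2^-1)%R by rewrite /r; field; rewrite gt_eqF.
have r1 : (r < 1)%R by nra.
have w0 := fine_unit_ball_volume_gt0 R (ltnW n1).
have t0 : (0 < 1 - r)%R by rewrite subr_gt0.
set w := fine _ in w0 *.
have L0 : (0 <= r `^ s * (n%:R / s) * w)%R.
  by rewrite !mulr_ge0 ?powR_ge0 ?invr_ge0 ?(ltW n0) ?(ltW s0) ?(ltW w0).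
apply: le_trans (best_const_ge s0 sn t0 L0
  (fun x => @conv_kernel_ge_near R n s s0 sn r x r0)).
rewrite -/w lee_fin; apply: ler_wpM2l.
  exact: mulr_ge0 (riesz_const_ge0 _ _) (powR_ge0 _ _).
rewrite mulfK ?gt_eqF//.
have tp : (2^-1 <= (1 - r) `^ (n%:R - s))%R.
  apply: (@le_trans _ _ ((1 - r) `^ n%:R)%R).
    rewrite powR_mulrn ?(ltW t0)//.
    apply: le_trans (bernoulli_le n _); first by rewrite nr; lra.
    by rewrite !ltW.
  by rewrite ger_powR// ?t0 gerBl ltW.
have rs : (n%:R^-1 <= r `^ s)%R.
  apply: (@le_trans _ _ (r `^ 2^-1)%R); last first.
    by rewrite ger_powR ?r0 ?ltW.
  have -> : (n%:R^-1 = (n%:R^-1 ^+ 2) `^ 2^-1 :> R)%R.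
    by rewrite powR12_sqrt ?sqr_ge0// sqrtr_sqr ger0_norm// invr_ge0 ltW.
  rewrite ge0_ler_powR ?nnegrE ?sqr_ge0 ?invr_ge0 ?(ltW r0)//.
  by rewrite /r exprVn lef_pV2 ?posrE ?mulr_gt0 ?exprn_gt0// expr2 ler_pM2l.
apply: (@le_trans _ _ (2^-1 * (n%:R^-1 * (n%:R / s)))%R).
  rewrite le_eqVlt; apply/orP; left; apply/eqP; field.
  by rewrite !gt_eqF.
apply: ler_pM => //.
  by rewrite !mulr_ge0 ?invr_ge0 ?(ltW n0) ?(ltW s0).
by rewrite ler_wpM2r// divr_ge0// ltW.
Qed.

(** Choose [t] so that [t / (t + 1) = 1 - (1 - c) / n], whose [n]-th power is at
    least [c] by Bernoulli's inequality. *)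
Lemma best_const_ge_far (R : realType) (n : nat) (s c : R) :
  (1 < n)%N -> (0 < s < n%:R)%R -> (0 <= c < 1)%R ->
  (riesz_const n s * fine (unit_ball_volume R n) `^ ((n%:R - s) / n%:R) *
    c)%R%:E <= best_const n s.
Proof.
move=> n1 /andP[s0 sn] /andP[c0 c1].
have n2 : (2 <= n%:R :> R)%R by rewrite ler_nat.
have n0 : (0 < n%:R :> R)%R by exact: lt_trans sn.
have c1' : (0 < 1 - c)%R by rewrite subr_gt0.
have w0 := fine_unit_ball_volume_gt0 R (ltnW n1).
pose t := (n%:R / (1 - c) - 1)%R : R.
have t0 : (0 < t)%R by rewrite subr_gt0 ltr_pdivlMr// mul1r; lra.
have t1 : (t + 1 = n%:R / (1 - c))%R by rewrite subrK.
have t1_gt0 : (0 < t + 1)%R by rewrite addr_gt0.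
set w := fine _ in w0 *.
have L0 : (0 <= (t + 1) `^ (- (n%:R - s)) * w)%R.
  by rewrite mulr_ge0 ?powR_ge0// ltW.
apply: le_trans (best_const_ge s0 sn t0 L0
  (fun x => @conv_kernel_ge_far R n s s0 sn t x t0)).
rewrite -/w lee_fin; apply: ler_wpM2l.
  exact: mulr_ge0 (riesz_const_ge0 _ _) (powR_ge0 _ _).
have xn : (n%:R * ((1 - c) / n%:R) = 1 - c)%R by field; rewrite gt_eqF.
have x01 : (0 <= (1 - c) / n%:R <= 1)%R.
  by rewrite (divr_ge0 (ltW c1') (ltW n0)) /= ler_pdivrMr// mul1r; lra.
have -> : ((t + 1) `^ (- (n%:R - s)) = (t + 1)^-1 `^ (n%:R - s))%R.
  by rewrite -powR_inv1 ?(ltW t1_gt0)// -powRrM mulN1r.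
rewrite mulfK ?gt_eqF// -powRM ?(ltW t0) ?invr_ge0 ?(ltW t1_gt0)//.
have -> : (t / (t + 1) = 1 - (1 - c) / n%:R)%R.
  by rewrite t1 /t; field; rewrite !gt_eqF.
have u01 : (0 < 1 - (1 - c) / n%:R <= 1)%R.
  rewrite subr_gt0 ltr_pdivrMr// mul1r gerBl (divr_ge0 (ltW c1') (ltW n0)).
  by rewrite andbT; lra.
apply: (@le_trans _ _ ((1 - (1 - c) / n%:R) `^ n%:R)%R); last first.
  by rewrite ger_powR// gerBl ltW.
rewrite powR_mulrn; last by case/andP: u01 => /ltW.
by apply: le_trans (bernoulli_le n x01); rewrite xn; lra.
Qed.

Theorem theorem1p3 (R : realType) (n : nat) (s : R)
  (hn : (2 < n)%N) (hs0 : (0 < s)%R) (hs : (s < (n%:R - 2) / 4)%R) :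
  (riesz_const n s)%:E * unit_ball_volume R n `^ ((n%:R - s) / n%:R) *
    ((n%:R - 2 - 4 * s) / (2 * s * (n%:R - 2 - s)))%R%:E
    <= best_const n s
  /\ best_const n s
    <= (riesz_const n s)%:E * unit_ball_volume R n `^ ((n%:R - s) / n%:R) *
       (n%:R / s)%R%:E.
Proof.
have n3 : (3 <= n%:R :> R)%R by rewrite ler_nat.
have n1 : (1 < n)%N by exact: ltn_trans hn.
have sn : (s < n%:R)%R by lra.
have q0 : (0 < n%:R - 2 - s)%R by lra.
have q4 : (0 < n%:R - 2 - 4 * s)%R by lra.
split; last exact: best_const_le.
rewrite -(fineK_unit_ball_volume R n) poweR_EFin -!EFinM.
set c := ((n%:R - 2 - 4 * s) / _)%R.
have c0 : (0 <= c)%R.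
  by rewrite divr_ge0 ?mulr_ge0 ?(ltW q0) ?(ltW q4) ?(ltW hs0).
have gw0 := mulr_ge0 (riesz_const_ge0 n s)
  (powR_ge0 (fine (unit_ball_volume R n)) ((n%:R - s) / n%:R)).
have [s12|s12] := ltP s (2^-1)%R.
  have cs : (c <= (2 * s)^-1)%R.
    rewrite /c ler_pdivrMr ?mulr_gt0// mulrA mulVf ?mul1r; first by lra.
    by rewrite gt_eqF ?mulr_gt0.
  apply: le_trans (best_const_ge_near n1 _); last by rewrite hs0.
  by rewrite lee_fin ler_wpM2l.
apply: best_const_ge_far; rewrite ?hs0// c0/=.
rewrite /c ltr_pdivrMr ?mulr_gt0// mul1r.
by nra.
Qed.
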